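(* Let $G=(V,E,\omega)$ be a finite weighted, undirected, connected graph with $n=|V|\ge 3$ vertices, $m=|E|$ edges and positive edge weights, and let $f$, $g$, $\Omega$ and $\mathcal{L}$ be the cost function, penalty function, set of admissible discrete solutions and loss defined in the context, with parameters $\alpha,\beta>0$. Let $\beta>\max_{S\in\Omega} f(S;G)$ and $\min_{S\in\Omega} f(S;G)\ge 0$. Suppose that the learned parameter $\theta$, with relaxed solution $\hat S=\mathcal{A}_\theta(G)\in[0,1]^n$, achieves $\mathcal{L}(\theta;G)<\alpha\cdot\beta$. Then deterministic rounding of the relaxed solution $\hat S$ yields a discrete solution $S\in\Omega$ such that $\alpha\cdot f(S;G)<\mathcal{L}(\theta;G)$.
   Context: Identify $V=\{1,\dots,n\}$ and let $A(G)=(a_{ij}(G))$ be the adjacency matrix of $G$. For $x=(x_1,\dots,x_n)\in[0,1]^n$: Cost: $f(x;G)=\gamma-\sum_{i<j}\omega_{ij}(x_i-x_j)^2$, where $\omega_{ij}$ is the weight of the edge $ij$ (and $0$ if $ij\notin E$), and $\gamma=\sum_{e\in E}\omega_e$ is the sum of all edge weights. Penalty: let $A_x$ be the symmetric $n\times n$ matrix with zero diagonal and off-diagonal entries $(1-x_i-x_j)^2a_{ij}(G)$, let $D_x$ be the diagonal matrix of row sums of $A_x$, and let $\lambda_1(x)\le\dots\le\lambda_n(x)$ be the eigenvalues of the Laplacian $D_x-A_x$. (For $x\in\{0,1\}^n$, $A_x$ is the adjacency matrix of the graph obtained from $G$ by deleting all edges joining a vertex labelled $0$ to a vertex labelled $1$.)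 Let $\lambda_3(G)$ be the third smallest eigenvalue of the Laplacian $D-A(G)$ of $G$. Fix a small $\epsilon\in(0,1)$ (e.g. $\epsilon=10^{-4}$), put $\tau=-\ln\epsilon/\lambda_3(G)>0$, and define $g(x;G)=e^{-\tau[\lambda_3(x)-\lambda_2(x)]}$. Constraint set: $\Omega=\{S\in\{0,1\}^n: g(S;G)\le 1\}$. Loss: $\mathcal{L}(x)=\alpha f(x;G)+\beta g(x;G)$, where $\alpha\in\{1,m/n\}$ and $\beta>0$. A model $\mathcal{A}_\theta$ with parameter $\theta$ maps $G$ to a relaxed solution $\hat S=\mathcal{A}_\theta(G)=(\hat x_1,\dots,\hat x_n)\in[0,1]^n$, and $\mathcal{L}(\theta;G):=\mathcal{L}(\hat S)$. Deterministic rounding of $\hat S\in[0,1]^n$: process the coordinates one at a time, $i=1,\dots,n$ (without loss of generality in this order); replace the $i$-th coordinate by the value $j\in\{0,1\}$ minimizing $\mathcal{L}$ with all other coordinates fixed at their current values. This yields $\bar S\in\{0,1\}^n$. If $\mathcal{L}(\hat S)>\mathcal{L}(\bar S)$, the output is $S=\bar S$. If $\mathcal{L}(\hat S)\le\mathcal{L}(\bar S)$, a coordinate $\bar x_i$ is changed to $1-\bar x_i$, chosen so as to minimize the number of zero eigenvalues of the associated Laplacian, giving a new discrete vector $S$; this is repeated until $\mathcal{L}(\hat S)>\mathcal{L}(S)$, and the output of the rounding is the vector $S\in\{0,1\}^n$ at which the procedure stops.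
   Formalization: The claim is proved for every vector S at which deterministic rounding stops; that the rounding stops is not asserted, since it can flip forever (e.g. the unit-weight triangle with relaxed solution (1,0,0), α=1, β=4). *)

(* Defs.v *)
(* MathComp and MathComp-Analysis; polyrcf provides the real roots of a polynomial. *)
From mathcomp Require Import all_boot all_order all_algebra.
From mathcomp Require Import all_classical all_reals all_analysis.
From mathcomp Require Import polyrcf.

Set Implicit Arguments.
Unset Strict Implicit.
Unset Printing Implicit Defensive.

Import Order.TTheory GRing.Theory Num.Theory.
Local Open Scope classical_set_scope.
Local Open Scope ring_scope.

Record wgraph (R : realType) (n : nat) := WGraph {
  edge : rel 'I_n;
  weight : 'I_n -> 'I_n -> R;
  edge_sym : symmetric edge;
  edge_irr : irreflexive edge;
  weight_sym : forall i j, weight i j = weight j i;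
  weight_gt0 : forall i j, edge i j -> 0 < weight i j;
  weight_eq0 : forall i j, ~~ edge i j -> weight i j = 0 }.

Definition connected_graph (R : realType) (n : nat) (G : wgraph R n) : Prop :=
  forall i j : 'I_n, connect (edge G) i j.

Definition num_edges (R : realType) (n : nat) (G : wgraph R n) : nat :=
  #|[set p : 'I_n * 'I_n | (p.1 < p.2)%N && edge G p.1 p.2]%SET|.

(* The real eigenvalues in increasing order, each repeated according to its
   algebraic multiplicity. It is applied only to symmetric matrices, whose
   characteristic polynomial splits over R, so no eigenvalue is lost. *)
Definition spectrum (R : realType) (n : nat) (M : 'M[R]_n) : seq R :=
  flatten [seq nseq (mup a (char_poly M)) a | a <- rootsR (char_poly M)].

(* The k-th smallest eigenvalue, counted from k = 1. *)
Definition eigval (R : realType) (n : nat) (k : nat) (M : 'M[R]_n) : R :=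
  (spectrum M)`_(k.-1).

Definition laplacian (R : realType) (n : nat) (A : 'M[R]_n) : 'M[R]_n :=
  diag_mx (\row_i \sum_j A i j) - A.

(* The 0/1 adjacency matrix; the weights enter the cost only. *)
Definition adjacency (R : realType) (n : nat) (G : wgraph R n) : 'M[R]_n :=
  \matrix_(i, j) (edge G i j)%:R.

(* The diagonal vanishes because edge G is irreflexive. *)
Definition relaxed_adjacency (R : realType) (n : nat) (G : wgraph R n)
    (x : 'rV[R]_n) : 'M[R]_n :=
  \matrix_(i, j) ((1 - x 0 i - x 0 j) ^+ 2 * adjacency G i j).

Definition relaxed_laplacian (R : realType) (n : nat) (G : wgraph R n)
    (x : 'rV[R]_n) : 'M[R]_n :=
  laplacian (relaxed_adjacency G x).

Definition total_weight (R : realType) (n : nat) (G : wgraph R n) : R :=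
  \sum_(i < n) \sum_(j < n | (i < j)%N && edge G i j) weight G i j.

Definition cost (R : realType) (n : nat) (G : wgraph R n) (x : 'rV[R]_n) : R :=
  total_weight G
  - \sum_(i < n) \sum_(j < n | (i < j)%N) weight G i j * (x 0 i - x 0 j) ^+ 2.

Definition tau (R : realType) (n : nat) (eps : R) (G : wgraph R n) : R :=
  - ln eps / eigval 3 (laplacian (adjacency G)).

Definition penalty (R : realType) (n : nat) (eps : R) (G : wgraph R n)
    (x : 'rV[R]_n) : R :=
  expR (- tau eps G * (eigval 3 (relaxed_laplacian G x)
                       - eigval 2 (relaxed_laplacian G x))).

Definition relaxed (R : realType) (n : nat) (x : 'rV[R]_n) : Prop :=
  forall i, 0 <= x 0 i <= 1.

Definition discrete (R : realType) (n : nat) (x : 'rV[R]_n) : Prop :=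
  forall i, x 0 i = 0 \/ x 0 i = 1.

Definition Omega (R : realType) (n : nat) (eps : R) (G : wgraph R n) :
    set 'rV[R]_n :=
  [set S | discrete S /\ penalty eps G S <= 1].

Definition loss (R : realType) (n : nat) (eps alpha beta : R) (G : wgraph R n)
    (x : 'rV[R]_n) : R :=
  alpha * cost G x + beta * penalty eps G x.

Definition set_coord (R : realType) (n : nat) (x : 'rV[R]_n) (i : 'I_n) (v : R) :
    'rV[R]_n :=
  \row_k (if k == i then v else x 0 k).

(* Relations rather than functions: a tie between two minimizing values may be
   broken either way. *)
Definition greedy_step (R : realType) (n : nat) (L : 'rV[R]_n -> R) (i : 'I_n)
    (x y : 'rV[R]_n) : Prop :=
  exists j : bool, y = set_coord x i j%:R /\
    forall j' : bool, L (set_coord x i j%:R) <= L (set_coord x i j'%:R).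

Fixpoint greedy_pass (R : realType) (n : nat) (L : 'rV[R]_n -> R)
    (s : seq 'I_n) (x y : 'rV[R]_n) : Prop :=
  if s is i :: s' then
    exists z, greedy_step L i x z /\ greedy_pass L s' z y
  else y = x.

Definition zero_eigenvalues (R : realType) (n : nat) (G : wgraph R n)
    (x : 'rV[R]_n) : nat :=
  count_mem 0 (spectrum (relaxed_laplacian G x)).

Definition flip (R : realType) (n : nat) (x : 'rV[R]_n) (i : 'I_n) : 'rV[R]_n :=
  set_coord x i (1 - x 0 i).

Definition flip_step (R : realType) (n : nat) (G : wgraph R n)
    (x y : 'rV[R]_n) : Prop :=
  exists i, y = flip x i /\
    forall k, (zero_eigenvalues G (flip x i) <= zero_eigenvalues G (flip x k))%N.

(* flip_until G L c x S: starting at x, flipping coordinates as long as the loss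
   is at least c, the procedure stops at S. Being inductive, it relates x only to
   vectors reached after finitely many flips. *)
Inductive flip_until (R : realType) (n : nat) (G : wgraph R n)
    (L : 'rV[R]_n -> R) (c : R) : 'rV[R]_n -> 'rV[R]_n -> Prop :=
| flip_stop x : L x < c -> flip_until G L c x x
| flip_next x y S : c <= L x -> flip_step G x y -> flip_until G L c y S ->
    flip_until G L c x S.

(* S is an output of deterministic rounding of Shat; enum 'I_n lists the
   coordinates in increasing order. *)
Definition rounds_to (R : realType) (n : nat) (eps alpha beta : R)
    (G : wgraph R n) (Shat S : 'rV[R]_n) : Prop :=
  exists Sbar, greedy_pass (loss eps alpha beta G) (enum 'I_n) Shat Sbar /\
    flip_until G (loss eps alpha beta G) (loss eps alpha beta G Shat) Sbar S.

Definition model_loss (R : realType) (n : nat) (eps alpha beta : R)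
    (Theta : Type) (model : Theta -> wgraph R n -> 'rV[R]_n) (theta : Theta)
    (G : wgraph R n) : R :=
  loss eps alpha beta G (model theta G).

(* Main.v *)
(* Every discrete vector lies in Omega: since 0 < eps < 1 and the Laplacian of G
   is positive semidefinite, tau >= 0, and lambda_2 <= lambda_3 makes the exponent
   of the penalty nonpositive. As the penalty is positive, alpha f(S) < L(S), and
   rounding stops only at a vector S with L(S) < L(Shat).
   The 3rd entry of the spectrum defaults to 0 when the list is too short, so
   lambda_2 <= lambda_3 needs all n eigenvalues to be real: this comes from the
   spectral theorem for the matrix seen as a Hermitian one over R[i]. *)
Require Import Defs.
From mathcomp Require Import all_boot all_order all_algebra.
From mathcomp Require Import all_classical all_reals all_analysis.
From mathcomp Require Import polyrcf complex.

Import Order.TTheory GRing.Theory Num.Theory.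
Local Open Scope classical_set_scope.
Local Open Scope ring_scope.

(** The scalar part of the characteristic matrix commutes with [P], so the whole characteristic
    matrix is conjugated and the two outer determinants cancel. *)
Lemma char_poly_conj {F : fieldType} {n : nat} (P A : 'M[F]_n) :
  P \in unitmx -> char_poly (invmx P *m A *m P) = char_poly A.
Proof.
move=> uP; rewrite /char_poly.
have -> : char_poly_mx (invmx P *m A *m P) =
    map_mx polyC (invmx P) *m char_poly_mx A *m map_mx polyC P.
  rewrite /char_poly_mx mulmxBr mulmxBl -!map_mxM /=; congr (_ - _).
  by rewrite mul_mx_scalar -scalemxAl -map_mxM mulVmx// map_mx1 scalemx1.
rewrite !det_mulmx mulrAC !det_map_mx -polyCM -det_mulmx mulVmx//.
by rewrite det1 mul1r.
Qed.

Lemma char_poly_sym_split {R : rcfType} {n : nat} (M : 'M[R]_n) :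
  M^T = M -> exists s : seq R, char_poly M = \prod_(a <- s) ('X - a%:P).
Proof.
move=> symM; pose toC := real_complex R; pose A := map_mx toC M.
have realA : A \is a mxOver Num.real.
  by apply/mxOverP => i j; rewrite mxE; apply/complex_realP; exists (M i j).
have symA : A \is symmetricmx.
  apply/is_hermitianmxP; rewrite expr0 scale1r map_mx_id//.
  by apply/matrixP => i j; rewrite !mxE -{1}symM mxE.
have hermA : A \is hermsymmx by exact: realsym_hermsym.
have /orthomx_spectralP eqA := hermitian_normalmx hermA.
have /mxOverP realD := hermitian_spectral_diag_real hermA.
(* The diagonal entries are real by [realD], so taking real parts loses nothing; the factorization
   is checked over [R[i]] and descends to [R] by injectivity of the embedding. *)
exists [seq complex.Re (spectral_diag A 0 i) | i <- enum 'I_n].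
apply: (map_poly_inj toC); rewrite map_char_poly.
have := char_poly_conj _ (diag_mx (spectral_diag A)) (spectral_unit A).
rewrite -eqA => ->; rewrite char_poly_trig ?diag_mx_is_trig// rmorph_prod big_map big_enum /=; apply: eq_bigr => i _.
by rewrite mxE eqxx mulr1n rmorphB /= map_polyX map_polyC /= /toC RRe_real.
Qed.

(** The multiplicity of a root [a] is its number of occurrences in [s], and the distinct roots are
    [undup s] up to order. *)
Lemma perm_spectrum {R : realType} {n : nat} (M : 'M[R]_n) (s : seq R) :
  char_poly M = \prod_(a <- s) ('X - a%:P) -> perm_eq (spectrum M) s.
Proof.
move=> eqM; rewrite /spectrum.
under eq_map => a do rewrite eqM mu_prod_XsubC.
apply: perm_trans (perm_count_undup s).
apply: perm_flatten; apply: perm_map; apply: uniq_perm.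
- exact: uniq_roots.
- exact: undup_uniq.
move=> a; rewrite mem_undup.
have p_neq0 : char_poly M != 0 by rewrite monic_neq0 ?char_poly_monic.
have := roots_on_rootsR p_neq0 a; rewrite /= => <-.
by rewrite eqM root_prod_XsubC.
Qed.

(** Comparing degrees. For [0 < k <= n] this ensures that [eigval k M] is a genuine eigenvalue and
    not the default 0. *)
Lemma size_spectrum {R : realType} {n : nat} (M : 'M[R]_n) :
  M^T = M -> size (spectrum M) = n.
Proof.
move=> /char_poly_sym_split[s eqM]; rewrite (perm_size (perm_spectrum _ _ eqM)).
by apply: succn_inj; rewrite -(size_char_poly M) eqM size_prod_XsubC.
Qed.

Lemma sorted_spectrum {R : realType} {n : nat} (M : 'M[R]_n) :
  sorted <=%R (spectrum M).
Proof.
rewrite /spectrum; have : sorted <%R (rootsR (char_poly M)) by exact: sorted_roots.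
(* The pairwise form splits over concatenation: blocks of distinct roots are ordered as the roots
   are, and each block is constant. *)
rewrite (sorted_pairwise lt_trans) (sorted_pairwise le_trans).
elim: (rootsR _) => [|a s IHs] //= /andP[/allP a_lt /IHs{}IHs].
rewrite pairwise_cat IHs andbT; apply/andP; split.
  apply/allrelP => x y /nseqP[-> _] /flatten_mapP[b /a_lt a_b /nseqP[-> _]].
  exact: ltW.
apply/(pairwiseP 0) => i j; rewrite !inE size_nseq => ltim ltjm _.
by rewrite !nth_nseq ltim ltjm.
Qed.

Lemma eigval_le {R : realType} {n : nat} (M : 'M[R]_n) (j k : nat) :
  M^T = M -> (j <= k <= n)%N -> (0 < j)%N -> eigval j M <= eigval k M.
Proof.
move=> symM /andP[le_jk le_kn] j_gt0; rewrite /eigval.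
have k_gt0 := leq_trans j_gt0 le_jk.
apply: (sorted_leq_nth le_trans (@lexx _ R) 0 (sorted_spectrum M));
  rewrite ?inE ?size_spectrum ?prednK//; last by rewrite -ltnS !prednK.
exact: leq_trans le_kn.
Qed.

Lemma laplacian_sym {R : realType} {n : nat} (A : 'M[R]_n) :
  A^T = A -> (laplacian A)^T = laplacian A.
Proof. by move=> symA; rewrite /laplacian linearB /= symA tr_diag_mx. Qed.

(** The Dirichlet form of the Laplacian, doubled because the sum runs over ordered pairs. Expanding
    the square gives the degree term [D] twice, by symmetry of [A], and the adjacency term [B] with
    factor -2. *)
Lemma laplacian_form {R : realType} {n : nat} (A : 'M[R]_n) (v : 'rV[R]_n) :
  A^T = A -> (v *m laplacian A *m v^T) 0 0 *+ 2 =
    \sum_i \sum_j A i j * (v 0 i - v 0 j) ^+ 2.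
Proof.
move=> symA; have Aji i j : A j i = A i j by rewrite -{1}symA mxE.
pose D := \sum_i \sum_j A i j * v 0 i ^+ 2.
pose B := \sum_i \sum_j A i j * (v 0 i * v 0 j).
have -> : \sum_i \sum_j A i j * (v 0 i - v 0 j) ^+ 2 = D - B *+ 2 + D.
  have {2}-> : D = \sum_i \sum_j A i j * v 0 j ^+ 2.
    by rewrite /D exchange_big; do 2!apply: eq_bigr => ? _; rewrite Aji.
  rewrite -sumrMnl -sumrB -big_split /=; apply: eq_bigr => i _.
  rewrite -sumrMnl -sumrB -big_split /=; apply: eq_bigr => j _.
  by rewrite sqrrB !mulrDr mulrN mulrnAr.
suff -> : (v *m laplacian A *m v^T) 0 0 = D - B.
  by rewrite mulrnBl [D *+ 2]mulr2n addrAC.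
rewrite /laplacian mulmxBr mulmxBl [LHS]mxE [X in _ + X]mxE; congr (_ - _).
  rewrite mul_mx_diag mxE; apply: eq_bigr => i _; rewrite !mxE.
  by rewrite mulrAC mulr_sumr; apply: eq_bigr => j _; rewrite mulrC.
rewrite mxE /B exchange_big; apply: eq_bigr => j _ /=; rewrite !mxE mulr_suml.
by apply: eq_bigr => i _; rewrite mulrA [v 0 i * _]mulrC.
Qed.

(** At an eigenvector [v] for [a], the nonnegative Dirichlet form equals [a] times twice the squared
    norm of [v], which is positive. An index beyond the spectrum gives the default 0. *)
Lemma eigval_laplacian_ge0 {R : realType} {n : nat} (A : 'M[R]_n) (k : nat) :
  A^T = A -> (forall i j, 0 <= A i j) -> 0 <= eigval k (laplacian A).
Proof.
move=> symA A_ge0; rewrite /eigval.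
have [le_size|lt_size] := leqP (size (spectrum (laplacian A))) k.-1.
  by rewrite nth_default.
have /flatten_mapP[a + /nseqP[-> _]] := mem_nth 0 lt_size.
rewrite in_roots => /andP[+ _]; rewrite -eigenvalue_root_char.
move=> /eigenvalueP[v eqv v_neq0].
have := laplacian_form A v symA.
rewrite eqv -scalemxAl mxE -mulrnAr => form_v.
have : 0 <= a * ((v *m v^T) 0 0 *+ 2).
  rewrite form_v; apply: sumr_ge0 => i _; apply: sumr_ge0 => j _.
  by rewrite mulr_ge0 ?sqr_ge0.
rewrite pmulr_lge0// pmulrn_lgt0// mxE.
have [i vi_neq0] : exists i, v 0 i != 0 by exact/rV0Pn.
rewrite (bigD1 i)//= mxE ltr_pwDl// -?expr2 ?exprn_even_gt0//.
by apply: sumr_ge0 => j _; rewrite mxE -expr2 sqr_ge0.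
Qed.

Lemma adjacency_tr {R : realType} {n : nat} (G : wgraph R n) :
  (adjacency G)^T = adjacency G.
Proof. by apply/matrixP => i j; rewrite !mxE edge_sym. Qed.

Lemma relaxed_adjacency_tr {R : realType} {n : nat} (G : wgraph R n)
    (x : 'rV[R]_n) : (relaxed_adjacency G x)^T = relaxed_adjacency G x.
Proof. by apply/matrixP => i j; rewrite !mxE edge_sym addrAC. Qed.

Lemma tau_ge0 {R : realType} {n : nat} (eps : R) (G : wgraph R n) :
  eps <= 1 -> 0 <= tau eps G.
Proof.
(* The inverse of 0 is 0 by convention, so a nonnegative denominator suffices. *)
move=> eps_le1; rewrite mulr_ge0 ?oppr_ge0 ?ln_le0// invr_ge0.
apply: eigval_laplacian_ge0; first exact: adjacency_tr.
by move=> i j; rewrite mxE.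
Qed.

Lemma penalty_le1 {R : realType} {n : nat} (eps : R) (G : wgraph R n)
    (x : 'rV[R]_n) : (3 <= n)%N -> eps <= 1 -> penalty eps G x <= 1.
Proof.
move=> n_ge3 eps_le1; rewrite /penalty -expR0 ler_expR mulNr oppr_le0.
rewrite mulr_ge0 ?tau_ge0// subr_ge0 eigval_le//.
by rewrite laplacian_sym// relaxed_adjacency_tr.
Qed.

(** The premise is the loop invariant: coordinates no longer awaiting processing are already 0 or
    1. *)
Lemma greedy_pass_discrete {R : realType} {n : nat} (L : 'rV[R]_n -> R)
    (s : seq 'I_n) (x y : 'rV[R]_n) :
  (forall i, i \notin s -> x 0 i = 0 \/ x 0 i = 1) ->
  greedy_pass L s x y -> discrete y.
Proof.
elim: s x => [|i s IHs] x /= discr_x; first by move=> -> k; exact: discr_x.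
move=> [z [[b [-> _]] pass_y]]; apply: IHs pass_y => k k_notin; rewrite mxE.
case: eqVneq => [_|k_neq_i]; first by case: b; [right|left].
by apply: discr_x; rewrite inE negb_or k_neq_i.
Qed.

Lemma flip_discrete {R : realType} {n : nat} (x : 'rV[R]_n) (i : 'I_n) :
  discrete x -> discrete (flip x i).
Proof.
move=> discr_x k; rewrite mxE; case: eqP => // _.
by have [->|->] := discr_x i; rewrite ?subr0 ?subrr; [right|left].
Qed.

Lemma flip_until_discrete {R : realType} {n : nat} (G : wgraph R n)
    (L : 'rV[R]_n -> R) (c : R) (x S : 'rV[R]_n) :
  flip_until G L c x S -> discrete x -> discrete S.
Proof.
elim=> // {}x y {}S _ [i [-> _]] _ IH discr_x.
exact: IH (flip_discrete _ i discr_x).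
Qed.

Lemma flip_until_lt {R : realType} {n : nat} (G : wgraph R n)
    (L : 'rV[R]_n -> R) (c : R) (x S : 'rV[R]_n) :
  flip_until G L c x S -> L S < c.
Proof. by elim. Qed.

Theorem theorem3 (R : realType) (n : nat) (hn : (3 <= n)%N)
  (G : wgraph R n) (Gconn : connected_graph G)
  (eps alpha beta : R) (heps : 0 < eps < 1)
  (halpha : alpha = 1 \/ alpha = (num_edges G)%:R / n%:R)
  (halpha0 : 0 < alpha) (hbeta0 : 0 < beta)
  (hmax : forall S, Omega eps G S -> cost G S < beta)
  (hmin : forall S, Omega eps G S -> 0 <= cost G S)
  (Theta : Type) (model : Theta -> wgraph R n -> 'rV[R]_n) (theta : Theta)
  (hrelaxed : relaxed (model theta G))
  (hloss : model_loss eps alpha beta model theta G < alpha * beta) :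
  forall S : 'rV[R]_n, rounds_to eps alpha beta G (model theta G) S ->
    Omega eps G S /\
    alpha * cost G S < model_loss eps alpha beta model theta G.
Proof.
move=> S [Sbar [pass_Sbar flips_S]].
have /andP[_ /ltW eps_le1] := heps.
split; last first.
  (* Strictness comes from the stopping rule; dropping the nonnegative penalty term can only lower
     the loss. *)
  apply: le_lt_trans (flip_until_lt _ _ _ _ _ flips_S).
  by rewrite lerDl mulr_ge0 ?expR_ge0 ?ltW.
split; last exact: penalty_le1.
apply: flip_until_discrete flips_S _.
(* The pass visits every coordinate, so the invariant holds vacuously at the start. *)
by apply: greedy_pass_discrete pass_Sbar => i; rewrite mem_enum.
Qed.
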